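(* Let $K\ge 2$ be an integer, $\ell\in\mathbb{R}$, $\sigma^2>0$, and let $\widehat\ell^{(1)},\ldots,\widehat\ell^{(K)}$ be i.i.d. $N(\ell,\sigma^2)$ random variables. Let $\bar\ell=\frac1K\sum_{k=1}^K\widehat\ell^{(k)}$ and $S_K^2=\frac{1}{K-1}\sum_{k=1}^K(\widehat\ell^{(k)}-\bar\ell)^2$. Then for every $\beta\ge 0$, $$\mathbb{E}\{F_\beta(S_K^2,K)\}=\exp\left(-\frac{\beta^2\sigma^2}{2K}\right),$$ and hence $$\mathbb{E}\{\exp(-\beta\bar\ell)\,F_\beta(S_K^2,K)\}=\exp(-\beta\ell).$$
   Context: For $s^2\ge 0$, $\beta\ge0$ and integer $K\ge2$, put $\nu=(K-3)/2$ and $z=z_\beta(s^2,K)=\beta\sqrt{(K-1)s^2/K}$. The Bessel factor is $$F_\beta(s^2,K)=\Gamma(\nu+1)\,(z/2)^{-\nu}J_\nu(z)\ \text{ if } z>0,\qquad F_\beta(s^2,K)=1\ \text{ if } z=0,$$ where $J_\nu$ is the Bessel function of the first kind of order $\nu$. *)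

(* Defs.v *)
From HB Require Import structures.
From mathcomp Require Import all_boot all_order all_algebra.
From mathcomp Require Import all_classical all_reals all_analysis.

Set Implicit Arguments.
Unset Strict Implicit.
Unset Printing Implicit Defensive.

Import Order.TTheory GRing.Theory Num.Theory.
Import numFieldNormedType.Exports.

Local Open Scope classical_set_scope.
Local Open Scope ring_scope.

(* Euler's integral: this is the Gamma function for 0 < x only (for x <= 0 the
   integral diverges and the value is 0, not the analytic continuation). *)
Definition Gamma (R : realType) (x : R) : R :=
  (\int[lebesgue_measure]_(t in `]0, +oo[) (t `^ (x - 1) * expR (- t)))%R.

(* J_nu(x) = sum_m (-1)^m / (m! Gamma(m + nu + 1)) (x / 2)^(2m + nu), to be used
   for nu > -1 (so that only positive arguments of Gamma occur) and x > 0. The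
   orders that occur below are nu = (K - 3) / 2 >= -1/2. *)
Definition besselJ (R : realType) (nu x : R) : R :=
  limn (series (fun m : nat =>
    (-1) ^+ m / (m`!%:R * Gamma (m%:R + nu + 1)) * (x / 2) `^ (2 * m%:R + nu))).

Definition bessel_order (R : realType) (K : nat) : R := (K%:R - 3) / 2.

Definition bessel_arg (R : realType) (beta s2 : R) (K : nat) : R :=
  beta * Num.sqrt ((K%:R - 1) * s2 / K%:R).

(* Meant for beta, s2 >= 0 and K >= 2, in which case bessel_arg is >= 0. *)
Definition bessel_factor (R : realType) (beta s2 : R) (K : nat) : R :=
  let nu := bessel_order R K in
  let z := bessel_arg beta s2 K in
  if 0 < z then Gamma (nu + 1) * (z / 2) `^ (- nu) * besselJ nu z else 1.

Definition sample_mean (R : realType) (K : nat) (x : 'I_K -> R) : R :=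
  K%:R^-1 * \sum_(k < K) x k.

Definition sample_var (R : realType) (K : nat) (x : 'I_K -> R) : R :=
  (K%:R - 1)^-1 * \sum_(k < K) (x k - sample_mean x) ^+ 2.

(* Mutual independence: product rule over every finite subfamily. *)
Definition independent_RVs (d : measure_display) (T : measurableType d)
    (R : realType) (P : probability T R) (I : finType)
    (X : I -> {RV P >-> R}) : Prop :=
  forall (J : {set I}) (A : I -> set R),
    (forall i, i \in J -> measurable (A i)) ->
    (P (\bigcap_(i in [set` J]) (X i @^-1` A i)) =
     \prod_(i in J) P (X i @^-1` A i))%E.

(* The N(mu, sigma^2) law; the parameter sigma of normal_prob is the standard
   deviation. *)
Definition normal_RV (d : measure_display) (T : measurableType d)
    (R : realType) (P : probability T R) (X : {RV P >-> R}) (mu sigma : R) :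
    Prop :=
  forall A : set R, measurable A ->
    distribution P X A = normal_prob mu sigma A.

(* Main.v *)
Require Import Defs.
From HB Require Import structures.
From mathcomp Require Import all_boot all_order all_algebra.
From mathcomp Require Import all_classical all_reals all_analysis.
From mathcomp Require Import finmap measurable_realfun ring lra.
From mathcomp Require mpoly.
(* The notations of mpoly clash with those of analysis. *)
Import -(notations) mpoly.

Set Implicit Arguments.
Unset Strict Implicit.
Unset Printing Implicit Defensive.

Import Order.TTheory GRing.Theory Num.Theory.
Import numFieldNormedType.Exports.

Local Open Scope classical_set_scope.
Local Open Scope ring_scope.

(* With a = (K - 1)/2 and Q = sum_k (X_k - mean)^2, the Bessel factor is the
   power series sum_n (-1)^n (beta^2 Q / (4 K))^n / (n! a (a+1) ... (a+n-1)),
   by the functional equation of Gamma. For any real c, weighting by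
   W = exp(-c sum_k X_k) shifts each Gaussian to mean l' = l - c sigma^2, so that
   the functional p |-> E(W p(X)) on polynomials satisfies Stein's identity
   E(W (X_k - l') p) = sigma^2 E(W d_k p). Since the deviations from the mean
   sum to 0, Q = sum_k (X_k - l') (X_k - mean), whence the recursion
   E(W Q^(n+1)) = sigma^2 (K - 1 + 2 n) E(W Q^n), whose factors cancel the
   denominators of the series: integrating termwise yields
   E(W) exp(- beta^2 sigma^2 / (2 K)). The two claims are the cases c = 0 and
   c = beta / K; the independence of the mean and Q is never needed. *)

(** * The functional equation of the Gamma function *)

Section gamma.
Context {R : realType}.
Local Notation mu := (@lebesgue_measure R).
Implicit Types (x t : R) (n : nat).

Definition gamma_fun x t : R := t `^ (x - 1) * expR (- t).

Lemma gamma_fun_ge0 x t : 0 <= gamma_fun x t.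
Proof. by rewrite mulr_ge0 ?powR_ge0 ?expR_ge0. Qed.

Lemma measurable_gamma_fun x : measurable_fun setT (gamma_fun x).
Proof.
apply: measurable_funM; first exact: (measurable_powR (x - 1)).
exact: measurableT_comp.
Qed.

Lemma measurable_EFin_gamma_fun D x :
  measurable_fun D (fun t => (gamma_fun x t)%:E).
Proof.
by apply/measurable_EFinP/measurable_funTS; exact: measurable_gamma_fun.
Qed.

Lemma powR_le_exprn x t n : 1 <= t -> x <= n%:R -> t `^ x <= t ^+ n.
Proof.
move=> t1 xn; rewrite -powR_mulrn; last exact: le_trans t1.
by rewrite ler_powR.
Qed.

Lemma powR_le_1Dexprn x t n : 0 <= x -> x <= n%:R -> 0 < t ->
  t `^ x <= 1 + t ^+ n.
Proof.
move=> x0 xn t0; have [t1|/ltW t1] := leP 1 t.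
  by rewrite (le_trans (powR_le_exprn t1 xn))// lerDr.
rewrite -[leLHS]addr0 lerD ?exprn_ge0 ?(ltW t0)//.
by rewrite -[leRHS](powRr0 t) ger_powR// t0.
Qed.

(** One term of the exponential series, that of degree n + 1, already bounds [expR t] from below;
    the extra degree leaves the decaying factor 1 / t. *)
Lemma exprn_expRN_le t n : 0 < t -> t ^+ n * expR (- t) <= n.+1`!%:R / t.
Proof.
move=> t0; rewrite expRN -/(_ / _) ler_pdivrMr ?expR_gt0//.
rewrite mulrAC ler_pdivlMr// -exprSr -ler_pdivrMl; last first.
  by rewrite ltr0n fact_gt0.
rewrite mulrC (le_trans _ (expR_ge1Dxn n (ltW t0)))//.
by rewrite lerDr.
Qed.

Lemma cvgn_powR_expRN x :
  (n.+2%:R `^ x * expR (- n.+2%:R) : R) @[n --> \oo] --> (0 : R).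
Proof.
have [N xN] : exists N, x <= N%:R.
  exists (Num.bound `|x|); rewrite (le_trans (ler_norm _))// ltW//.
  exact: archi_boundP.
apply: (@squeeze_cvgr _ _ _ _ (fun=> 0) (fun n => N.+1`!%:R * n.+2%:R^-1)).
- near=> n; rewrite mulr_ge0 ?powR_ge0 ?expR_ge0//=.
  rewrite (le_trans _ (exprn_expRN_le _ _))//.
  by rewrite ler_wpM2r ?expR_ge0// powR_le_exprn// ler1n.
- exact: cvg_cst.
- rewrite -(mulr0 (N.+1`!%:R)); apply: cvgMr.
  have := @cvg_harmonic R; rewrite -(cvg_shiftS (@harmonic R)).
  exact.
Unshelve. all: by end_near. Qed.

(** On a compact interval away from 0 the power t^x is differentiable for every real x. The boundary
    terms are kept, to be sent to 0 in [integral_gamma_funD1]. *)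
Lemma gamma_fun_by_parts x (a b : R) : 0 < a -> a < b ->
  (\int[mu]_(t in `[a, b]) (x * gamma_fun x t)%:E =
   (expR (- b) * b `^ x - expR (- a) * a `^ x)%:E +
   \int[mu]_(t in `[a, b]) (gamma_fun (x + 1) t)%:E)%E.
Proof.
move=> a0 ab.
have pos t : t \in `[a, b] -> 0 < t.
  by rewrite in_itv/= => /andP[+ _]; exact: lt_le_trans.
have cpow y : {within `[a, b], continuous (fun t => t `^ y)}.
  apply: derivable_within_continuous => t /pos t0.
  by apply: derivable_powR; rewrite in_itv/= t0.
have cexp : {within `[a, b], continuous (fun t => expR (- t))}.
  apply: continuous_subspaceT => t; apply: continuous_comp => //.
    exact: opp_continuous.
  exact: continuous_expR.
have LR (f : R -> R) : {within `[a, b], continuous f} ->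
    (forall t, t \in `]a, b[ -> derivable f t 1) ->
    derivable_oo_LRcontinuous f a b.
  move=> /(continuous_within_itvP _ ab)[_ ca cb] df; split => //.
rewrite -(_ : \int[mu]_(t in `[a, b]) (expR (- t) * (x * t `^ (x - 1)))%:E =
   \int[mu]_(t in `[a, b]) (x * gamma_fun x t)%:E)%E; last first.
  by apply: eq_integral => t _; rewrite /gamma_fun mulrCA (mulrC (expR _)).
rewrite (@integration_by_parts R (fun t => expR (- t)) (fun t => t `^ x)
  (fun t => - expR (- t)) (fun t => x * t `^ (x - 1))) //.
- congr (_ + _)%E.
  under eq_integral => t _.
    rewrite (_ : (- expR (- t) * t `^ x)%:E = - (gamma_fun (x + 1) t)%:E)%E.
      over.
    by rewrite /gamma_fun addrK -EFinN mulrC mulrN.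
  by rewrite integral_ge0N ?oppeK// => t _; rewrite lee_fin gamma_fun_ge0.
- by apply: derivable_within_continuous => t _; exact: ex_derive.
- by apply: LR => // t _; exact: ex_derive.
- by move=> t _; rewrite derive1E derive_val mulrN1.
- apply: derivable_within_continuous => t /pos t0.
  by apply: derivableM => //; apply: derivable_powR; rewrite in_itv/= t0.
- apply: LR => // t tab; apply: derivable_powR; rewrite in_itv/= andbT pos//.
  exact: subset_itv_oo_cc.
- move=> t tab; rewrite derive1E.
  have t0 : 0 < t by rewrite pos//; exact: subset_itv_oo_cc.
  by have /@derive_val := is_derive1_powR x t0.
Qed.

(** Starting the exhaustion at 2 keeps the endpoints strictly ordered, 1 / (n + 2) < n + 2, as the
    integration by parts requires. *)
Lemma itv0y_bigcup :
  `]0, +oo[%classic = \bigcup_n `[n.+2%:R^-1, n.+2%:R]%classic :> set R.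
Proof.
apply/seteqP; split => [t|t [n _]]; rewrite /= !in_itv/= andbT.
  move=> t0; pose m := maxn (Num.bound t) (Num.bound t^-1).
  have tm : t < m%:R.
    by rewrite (lt_le_trans (archi_boundP (ltW t0)))// ler_nat leq_maxl.
  have tVm : t^-1 < m%:R.
    rewrite (lt_le_trans (archi_boundP _)) ?invr_ge0 ?(ltW t0)//.
    by rewrite ler_nat leq_maxr.
  have mm : m%:R <= m.+2%:R :> R by rewrite ler_nat -addn2 leq_addr.
  exists m => //=; rewrite in_itv/= (le_trans (ltW tm))// andbT.
  by rewrite -[leRHS]invrK lef_pV2 ?posrE ?invr_gt0// (le_trans (ltW tVm)).
by move=> /andP[+ _]; apply: lt_le_trans; rewrite invr_gt0.
Qed.

Lemma cvgn_integral_gamma_fun x :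
  (\int[mu]_(t in `[(n.+2%:R^-1)%R, n.+2%:R%R]) (gamma_fun x t)%:E
     @[n --> \oo] -->
   \int[mu]_(t in `]0%R, +oo[) (gamma_fun x t)%:E)%E.
Proof.
rewrite itv0y_bigcup.
apply: ge0_nondecreasing_set_cvg_integral => //.
- move=> m n mn; rewrite subsetEset; apply: subset_itv; rewrite bnd_simp.
    by rewrite lef_pV2 ?posrE ?ltr0n// ler_nat !ltnS.
  by rewrite ler_nat !ltnS.
- by move=> n; exact: measurable_EFin_gamma_fun.
- by move=> n t _; rewrite lee_fin gamma_fun_ge0.
Qed.

(** Limit of the integration by parts along the exhaustion: the boundary term dies at infinity by
    exponential decay, and at 0 because x > 0. The identity lives in the extended reals, since
    finiteness of the integrals is deduced from it afterwards. *)
Lemma integral_gamma_funD1 x : 0 < x ->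
  (x%:E * \int[mu]_(t in `]0%R, +oo[) (gamma_fun x t)%:E =
   \int[mu]_(t in `]0%R, +oo[) (gamma_fun (x + 1) t)%:E)%E.
Proof.
move=> x0; pose I (y : R) n : \bar R :=
  (\int[mu]_(t in `[(n.+2%:R^-1)%R, n.+2%:R%R]) (gamma_fun y t)%:E)%E.
pose e n : R := expR (- n.+2%:R) * n.+2%:R `^ x -
  expR (- n.+2%:R^-1) * n.+2%:R^-1 `^ x.
have IE n : (x%:E * I x n = (e n)%:E + I (x + 1)%R n)%E.
  rewrite -gamma_fun_by_parts ?invr_gt0//; last first.
    by rewrite (@lt_trans _ _ 1)// ?invf_lt1// ltr1n.
  under [RHS]eq_integral do rewrite EFinM.
  rewrite ge0_integralZl_EFin ?(ltW x0)//.
    by move=> t _; rewrite lee_fin gamma_fun_ge0.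
  exact: measurable_EFin_gamma_fun.
have e0 : e n @[n --> \oo] --> 0.
  rewrite -[0]subr0; apply: cvgB.
    under eq_fun do rewrite mulrC.
    exact: cvgn_powR_expRN.
  have inv0 : (n.+2%:R^-1 : R) @[n --> \oo] --> 0.
    by have := @cvg_harmonic R; rewrite -(cvg_shiftS (@harmonic R)); exact.
  apply: (@squeeze_cvgr _ _ _ _ (fun=> 0) (fun n => n.+2%:R^-1 `^ x)).
  - near=> n; rewrite mulr_ge0 ?powR_ge0 ?expR_ge0//=.
    by rewrite ler_piMl ?powR_ge0// expR_le1 oppr_le0 invr_ge0.
  - exact: cvg_cst.
  - have inv0r : (n.+2%:R^-1 : R) @[n --> \oo] --> 0^'+.
      move=> A /inv0; apply: (@filterS _ \oo%classic) => n /=; apply.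
      by rewrite invr_gt0.
    exact: (cvg_comp _ _ inv0r (powR_cvg0 x0)).
have h1 : (x%:E * I x n @[n --> \oo] -->
    x%:E * \int[mu]_(t in `]0%R, +oo[) (gamma_fun x t)%:E)%E.
  by apply: cvgeZl => //; exact: cvgn_integral_gamma_fun.
have h2 : ((e n)%:E + I (x + 1)%R n @[n --> \oo] -->
    0%:E + \int[mu]_(t in `]0%R, +oo[) (gamma_fun (x + 1) t)%:E)%E.
  apply: cvgeD => //; last exact: cvgn_integral_gamma_fun.
  exact: cvg_comp e0 _.
rewrite add0e in h2.
rewrite -(funext IE) in h2.
by rewrite -(cvg_lim _ h1)// -(cvg_lim _ h2).
Unshelve. all: by end_near. Qed.

(** At 1 the integrand is the density of the exponential law of rate 1; the functional equation then
    climbs through the integers. *)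
Lemma integral_gamma_funS n :
  (\int[mu]_(t in `]0%R, +oo[) (gamma_fun n.+1%:R t)%:E < +oo)%E.
Proof.
elim: n => [|n ih]; last first.
  rewrite -[in gamma_fun _]natr1 -integral_gamma_funD1//.
  by rewrite lte_mul_pinfty.
apply: (@le_lt_trans _ _ (\int[mu]_t (exponential_pdf 1 t)%:E)%E); last first.
  by rewrite integral_exponential_pdf ?ltry.
have m1 : measurable_fun setT (EFin \o exponential_pdf (1 : R)).
  by apply/measurable_EFinP; exact: measurable_exponential_pdf.
apply: (@le_trans _ _ (\int[mu]_(t in `]0%R, +oo[) (exponential_pdf 1 t)%:E)%E).
  apply: ge0_le_integral => //=.
  - by move=> t _; rewrite lee_fin gamma_fun_ge0.
  - exact: measurable_EFin_gamma_fun.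
  - exact: measurable_funTS.
  - move=> t; rewrite in_itv/= andbT => t0.
    by rewrite /gamma_fun subrr powRr0 exponential_pdfE ?(ltW t0)// !mul1r mulN1r.
apply: ge0_subset_integral => //= t _.
by rewrite lee_fin exponential_pdf_ge0.
Qed.

(** Multiplication by x > 0 preserves an infinite value, so it suffices to bound the integral at x +
    1. There the singularity at 0 is gone, and t^x <= 1 + t^n reduces the claim to integer
    arguments. *)
Lemma integral_gamma_fun_fin_num x : 0 < x ->
  (\int[mu]_(t in `]0%R, +oo[) (gamma_fun x t)%:E)%E \is a fin_num.
Proof.
move=> x0; rewrite ge0_fin_numE; last first.
  by apply: integral_ge0 => t _; rewrite lee_fin gamma_fun_ge0.
suff : (x%:E * \int[mu]_(t in `]0%R, +oo[) (gamma_fun x t)%:E < +oo)%E.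
  move: (\int[mu]_(t in _) _)%E => [r||]; rewrite ?ltry ?ltNyr//.
  by rewrite gt0_muley.
rewrite integral_gamma_funD1//.
pose n := Num.bound x.
apply: (@le_lt_trans _ _ (\int[mu]_(t in `]0%R, +oo[)
    ((gamma_fun 1%:R t)%:E + (gamma_fun n.+1%:R t)%:E))%E).
  apply: ge0_le_integral => //=.
  - by move=> t _; rewrite lee_fin gamma_fun_ge0.
  - exact: measurable_EFin_gamma_fun.
  - by apply: emeasurable_funD; exact: measurable_EFin_gamma_fun.
  - move=> t; rewrite in_itv/= andbT => t0.
    rewrite -EFinD lee_fin /gamma_fun addrK mulr1n subrr powRr0 -mulrDl.
    rewrite ler_wpM2r ?expR_ge0// -natr1 addrK powR_mulrn ?(ltW t0)//.
    by rewrite powR_le_1Dexprn ?(ltW x0)// ltW// archi_boundP// ltW.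
rewrite ge0_integralD//=.
- by rewrite lte_add_pinfty// integral_gamma_funS.
- by move=> t _; rewrite lee_fin gamma_fun_ge0.
- exact: measurable_EFin_gamma_fun.
- by move=> t _; rewrite lee_fin gamma_fun_ge0.
- exact: measurable_EFin_gamma_fun.
Qed.

Lemma GammaD1 x : 0 < x -> Gamma (x + 1) = x * Gamma x.
Proof.
move=> x0; rewrite /Gamma /Rintegral -integral_gamma_funD1// fineM//.
exact: integral_gamma_fun_fin_num.
Qed.

(** As [fine] sends an infinite integral to 0, both finiteness and a positive lower bound are called
    for. *)
Lemma Gamma_gt0 x : 0 < x -> 0 < Gamma x.
Proof.
move=> x0; rewrite fine_gt0//.
have := integral_gamma_fun_fin_num x0; rewrite ge0_fin_numE => [->|]; last first.
  by apply: integral_ge0 => t _; rewrite lee_fin gamma_fun_ge0.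
rewrite andbT.
(* On [1, 2] one has t^(x - 1) >= 1 / t >= 1 / 2, because x > 0, and exp(- t) >= exp(- 2). *)
apply: (@lt_le_trans _ _ (\int[mu]_(t in `[1%R, 2%R]) (2^-1 * expR (- 2))%:E)%E).
  rewrite integral_cst//= lebesgue_measure_itv/= lte_fin ltr1n/= -EFinB -EFinM.
  by rewrite lte_fin !mulr_gt0 ?expR_gt0// subr_gt0 ltr1n.
apply: (@le_trans _ _ (\int[mu]_(t in `[1%R, 2%R]) (gamma_fun x t)%:E)%E).
  apply: ge0_le_integral => //=.
  - exact: measurable_EFin_gamma_fun.
  - move=> t; rewrite in_itv/= => /andP[t1 t2]; rewrite lee_fin ler_pM ?expR_ge0//.
      have t0 : 0 < t by exact: lt_le_trans t1.
      apply: (@le_trans _ _ (t `^ (-1))).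
        by rewrite powR_inv1 ?(ltW t0)// lef_pV2 ?posrE.
      by rewrite ler_powR// -[leLHS]add0r lerD2r ltW.
    by rewrite ler_expR lerN2.
apply: ge0_subset_integral => //=.
- exact: measurable_EFin_gamma_fun.
- by move=> t _; rewrite lee_fin gamma_fun_ge0.
- move=> t; rewrite /= !in_itv/= andbT => /andP[t1 _].
  exact: lt_le_trans t1.
Qed.

Lemma GammaDn x n : 0 < x ->
  Gamma (n%:R + x) = (\prod_(i < n) (i%:R + x)) * Gamma x.
Proof.
move=> x0; elim: n => [|n ih]; first by rewrite big_ord0 mul1r add0r.
rewrite big_ord_recr/= -natr1 addrAC GammaD1 ?ih; last by rewrite ltr_wpDl.
by rewrite mulrA (mulrC (n%:R + x)).
Qed.

End gamma.

(** * Expectations of products of independent random variables *)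

Section integral_comp.
Context d1 d (T1 : measurableType d1) (T : measurableType d) (R : realType).
Import HBNNSimple.

Lemma integral_mul_nnsfun_comp (m : {measure set T1 -> \bar R}) (X : T1 -> T)
    (g : T1 -> R) (s : {nnsfun T >-> R}) :
  measurable_fun setT X -> measurable_fun setT g -> (forall x, 0 <= g x) ->
  (\int[m]_x (g x * s (X x))%:E =
   \sum_(r <- fset_set (range s))
     r%:E * \int[m]_x (g x * \1_(s @^-1` [set r]) (X x))%:E)%E.
Proof.
move=> mX mg g0.
have mi r : measurable_fun setT (fun x => g x * \1_(s @^-1` [set r]) (X x)).
  by apply: measurable_funM => //; exact: (measurableT_comp _ mX).
have s0 r : r \in fset_set (range s) -> 0 <= r.
  by rewrite in_fset_set// => /set_mem[z _ <-]; exact: fun_ge0.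
under eq_integral do rewrite fimfunE fsbig_finite//= mulr_sumr -sumEFin.
rewrite ge0_integral_sum//=.
- apply: eq_big_seq => r rs.
  under eq_integral do rewrite mulrCA EFinM.
  rewrite ge0_integralZl_EFin//= ?s0//.
    by move=> x _; rewrite lee_fin mulr_ge0.
  by apply/measurable_EFinP; exact: mi.
- move=> r; apply/measurable_EFinP.
  under eq_fun do rewrite mulrCA.
  by apply: measurable_funM => //; exact: mi.
- move=> r x _; rewrite lee_fin mulr_ge0// -lee_fin EFinM.
  exact: nnfun_muleindic_ge0.
Qed.

Lemma cvg_integral_mul_nnsfun_comp (m : {measure set T1 -> \bar R})
    (X : T1 -> T) (g : T1 -> R) (f : T -> R) (mf : measurable_fun setT f) :
  measurable_fun setT X -> measurable_fun setT g -> (forall x, 0 <= g x) ->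
  (forall y, 0 <= f y) ->
  (\int[m]_x (g x * nnsfun_approx measurableT
      (measurableT_comp (@EFin_measurable R setT) mf) n (X x))%:E @[n --> \oo] -->
   \int[m]_x (g x * f (X x))%:E)%E.
Proof.
move=> mX mg g0 f0.
set s := nnsfun_approx _ _.
have sf x : (g x * s n (X x))%:E @[n --> \oo] --> (g x * f (X x))%:E.
  rewrite EFinM; under eq_fun do rewrite EFinM.
  apply: cvgeZl => //; apply: cvg_nnsfun_approx => // y _.
  by rewrite lee_fin.
under [X in _ --> X]eq_integral => x _ do rewrite -(cvg_lim _ (sf x))//.
apply: cvg_monotone_convergence => //=.
- move=> n; apply/measurable_EFinP; apply: measurable_funM => //.
  exact: (measurableT_comp _ mX).
- by move=> n x _; rewrite lee_fin mulr_ge0.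
- move=> x _ a b ab; rewrite lee_fin ler_wpM2l//.
  by apply: (lefP _ _ (nd_nnsfun_approx _ _ ab)).
Qed.

End integral_comp.

Section integral_comp_eq.
Import HBNNSimple.

(** Agreement on indicators passes to simple functions by linearity and to nonnegative functions by
    monotone convergence. The weights serve two uses: a factor independent of the variable, and a
    density on the line. *)
Lemma ge0_integral_comp_eq d1 d2 d (T1 : measurableType d1)
    (T2 : measurableType d2) (T : measurableType d) (R : realType)
    (m1 : {measure set T1 -> \bar R}) (m2 : {measure set T2 -> \bar R})
    (X1 : T1 -> T) (X2 : T2 -> T) (g1 : T1 -> R) (g2 : T2 -> R) (f : T -> R) :
  measurable_fun setT X1 -> measurable_fun setT X2 ->
  measurable_fun setT g1 -> measurable_fun setT g2 ->
  (forall x, 0 <= g1 x) -> (forall x, 0 <= g2 x) ->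
  (forall A, measurable A ->
    \int[m1]_x (g1 x * \1_A (X1 x))%:E = \int[m2]_x (g2 x * \1_A (X2 x))%:E)%E ->
  measurable_fun setT f -> (forall y, 0 <= f y) ->
  (\int[m1]_x (g1 x * f (X1 x))%:E = \int[m2]_x (g2 x * f (X2 x))%:E)%E.
Proof.
move=> mX1 mX2 mg1 mg2 g10 g20 H mf f0.
have h1 := cvg_integral_mul_nnsfun_comp (m := m1) mf mX1 mg1 g10 f0.
have h2 := cvg_integral_mul_nnsfun_comp (m := m2) mf mX2 mg2 g20 f0.
rewrite -(cvg_lim _ h1)// -(cvg_lim _ h2)//; congr (limn _); apply/funext => n.
rewrite !integral_mul_nnsfun_comp//; apply: eq_bigr => r _.
by rewrite H//; exact: measurable_funPTI.
Qed.

End integral_comp_eq.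

Section independence.
Context d (T : measurableType d) (R : realType) (P : probability T R)
  (I : finType) (X : I -> {RV P >-> R}).
Hypothesis X_indep : independent_RVs X.

Lemma integral_prod_indic (A : I -> set R) : (forall i, measurable (A i)) ->
  (\int[P]_w (\prod_i \1_(A i) (X i w))%:E =
   \prod_i \int[P]_w (\1_(A i) (X i w))%:E)%E.
Proof.
move=> mA.
have mXA i : measurable (X i @^-1` A i) by exact: measurable_funPTI.
transitivity (P (\bigcap_(i in [set` [set: I]%SET]) (X i @^-1` A i))).
  rewrite -[X in P X]setIT -integral_indic//; last first.
    by apply: fin_bigcap_measurable => //; exact: finite_finset.
  apply: eq_integral => w _; congr (_%:E).
  rewrite [RHS]indicE; case: (boolP (_ \in _)) => [/set_mem h|/negP h].
    by rewrite big1// => i _; rewrite indicE mem_set//; apply: h => /=.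
  have [i Xi] : exists i, ~ A i (X i w).
    apply/not_existsP => h'; apply: h; apply/mem_set => i _ /=.
    exact: contrapT (h' i).
  by rewrite (bigD1 i)//= indicE memNset// mul0r.
rewrite X_indep//; apply: eq_big => [i|i _]; first by rewrite inE.
by rewrite -[in LHS](setIT (_ @^-1` _)) -integral_indic.
Qed.

(** Indicators are exchanged for general functions one index at a time: in the induction, factors
    outside the list [s] are still indicators. At the new index the product of all other factors
    acts as the weight of [ge0_integral_comp_eq], against the constant weight given by the product
    of their means. *)
Lemma ge0_Rintegral_prod (f : I -> R -> R) :
  (forall i, measurable_fun setT (f i)) -> (forall i x, 0 <= f i x) ->
  (forall i, P.-integrable setT (fun w => (f i (X i w))%:E)) ->
  (\int[P]_w (\prod_i f i (X i w))%:E =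
   (\prod_i \int[P]_w f i (X i w))%:E)%E.
Proof.
move=> mf f0 intf.
suff H (s : seq I) : forall g : I -> R -> R,
    (forall i, measurable_fun setT (g i)) -> (forall i x, 0 <= g i x) ->
    (forall i, P.-integrable setT (fun w => (g i (X i w))%:E)) ->
    (forall i, i \notin s -> exists2 A, measurable A & g i = \1_A) ->
    (\int[P]_w (\prod_i g i (X i w))%:E =
      (\prod_i \int[P]_w g i (X i w))%:E)%E.
  by apply: (H (enum I)) => // i; rewrite mem_enum.
elim: s => [|i s ih] g mg g0 intg gs.
  have {gs} /choice[A AP] i : exists A, measurable A /\ g i = \1_A.
    by have [//|A mA gA] := gs i; exists A.
  under eq_integral do under eq_bigr do rewrite (AP _).2.
  rewrite integral_prod_indic; last by move=> i; exact: (AP i).1.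
  rewrite -prodEFin; apply: eq_bigr => i _.
  by rewrite (AP i).2 /Rintegral fineK// -(AP i).2 integrable_fin_num.
pose upd B j : R -> R := if j == i then \1_B else g j.
have updi B : upd B i = \1_B by rewrite /upd eqxx.
have updN B j : j != i -> upd B j = g j by rewrite /upd => /negbTE ->.
have key B : measurable B ->
    (\int[P]_w (\prod_j upd B j (X j w))%:E =
      (\prod_j \int[P]_w upd B j (X j w))%:E)%E.
  move=> mB; apply: ih => [j|j x|j|j js]; have [->|ji] := eqVneq j i.
  - by rewrite updi.
  - by rewrite updN.
  - by rewrite updi.
  - by rewrite updN.
  - by rewrite updi; apply: integrable_indic; exact: measurable_funPTI.
  - by rewrite updN.
  - by rewrite updi; exists B.
  - by rewrite updN//; apply: gs; rewrite inE negb_or ji.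
pose rest w := \prod_(j | j != i) g j (X j w).
pose c := \prod_(j | j != i) \int[P]_w g j (X j w).
have mrest : measurable_fun setT rest.
  rewrite /rest; under eq_fun do rewrite -big_filter.
  apply: measurable_prod => j _.
  by apply: measurableT_comp => //; exact: measurable_funP.
have rest0 w : 0 <= rest w by exact: prodr_ge0.
have c0 : 0 <= c by apply: prodr_ge0 => j _; exact: Rintegral_ge0.
have scale (h : R -> R) : P.-integrable setT (fun w => (h (X i w))%:E) ->
    (\int[P]_w (c * h (X i w))%:E = (c * \int[P]_w h (X i w))%:E)%E.
  move=> inth; under eq_integral do rewrite EFinM.
  by rewrite integralZl// EFinM /Rintegral fineK// integrable_fin_num.
have split_ (h : R -> R) w :
    \prod_j (if j == i then h else g j) (X j w) = rest w * h (X i w).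
  rewrite (bigD1 i)//= eqxx mulrC; congr (_ * _).
  by apply: eq_bigr => j /negbTE ->.
under eq_integral do rewrite (bigD1 i)//= mulrC -/(rest _).
rewrite [in RHS](bigD1 i)//= mulrC -/c -scale//.
apply: (@ge0_integral_comp_eq _ _ _ _ _ _ _ P P (X i) (X i) rest (cst c)) => //.
move=> B mB; rewrite scale; last first.
  by apply: integrable_indic; exact: measurable_funPTI.
under eq_integral do rewrite -split_.
rewrite key//; congr EFin; rewrite (bigD1 i)//= updi mulrC; congr (_ * _).
by apply: eq_bigr => j ji; rewrite updN.
Qed.

(** The absolute value of a product is the product of absolute values, to which the nonnegative case
    applies. *)
Lemma integrable_prod (f : I -> R -> R) :
  (forall i, measurable_fun setT (f i)) ->
  (forall i, P.-integrable setT (fun w => (f i (X i w))%:E)) ->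
  P.-integrable setT (fun w => (\prod_i f i (X i w))%:E).
Proof.
move=> mf intf; have mfX i : measurable_fun setT (fun w => f i (X i w)).
  by apply: measurableT_comp => //; exact: measurable_funP.
apply/integrableP; split.
  by apply/measurable_EFinP; apply: measurable_prod => i _.
under eq_integral do rewrite /= normr_prod.
rewrite (@ge0_Rintegral_prod (fun i x => `|f i x|)) ?ltry// => i.
  exact: measurableT_comp.
exact: integrable_norm (intf i).
Qed.

Lemma Rintegral_prod (f : I -> R -> R) :
  (forall i, measurable_fun setT (f i)) ->
  (forall i, P.-integrable setT (fun w => (f i (X i w))%:E)) ->
  \int[P]_w (\prod_i f i (X i w)) = \prod_i \int[P]_w f i (X i w).
Proof.
suff H (s : seq I) : forall g : I -> R -> R,
    (forall i, measurable_fun setT (g i)) ->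
    (forall i, P.-integrable setT (fun w => (g i (X i w))%:E)) ->
    (forall i, i \notin s -> forall x, 0 <= g i x) ->
  \int[P]_w (\prod_i g i (X i w)) = \prod_i \int[P]_w g i (X i w).
  by move=> mf intf; apply: (H (enum I)) => // i; rewrite mem_enum.
elim: s => [|i s ih] g mg intg gs.
  by rewrite /Rintegral ge0_Rintegral_prod// => i; exact: gs.
pose upd h j : R -> R := if j == i then h else g j.
have updi h : upd h i = h by rewrite /upd eqxx.
have updN h j : j != i -> upd h j = g j by rewrite /upd => /negbTE ->.
have split_ h w : \prod_j upd h j (X j w) =
    h (X i w) * \prod_(j | j != i) g j (X j w).
  rewrite (bigD1 i)//= updi; congr (_ * _).
  by apply: eq_bigr => j ji; rewrite updN.
have key (h : R -> R) : measurable_fun setT h -> (forall x, 0 <= h x) ->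
    P.-integrable setT (fun w => (h (X i w))%:E) ->
    P.-integrable setT
      (fun w => (h (X i w) * \prod_(j | j != i) g j (X j w))%:E) /\
    \int[P]_w (h (X i w) * \prod_(j | j != i) g j (X j w)) =
    (\int[P]_w h (X i w)) * \prod_(j | j != i) \int[P]_w g j (X j w).
  move=> mh h0 inth.
  have mu' j : measurable_fun setT (upd h j).
    by have [->|ji] := eqVneq j i; rewrite ?updi// updN.
  have iu j : P.-integrable setT (fun w => (upd h j (X j w))%:E).
    by have [->|ji] := eqVneq j i; rewrite ?updi// updN.
  split.
    by under eq_fun do rewrite -split_; exact: integrable_prod.
  under eq_Rintegral do rewrite -split_.
  rewrite ih//.
    rewrite (bigD1 i)//= updi; congr (_ * _).
    by apply: eq_bigr => j ji; rewrite updN.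
  move=> j js x; have [->|ji] := eqVneq j i; first by rewrite updi.
  by rewrite updN//; apply: gs; rewrite inE negb_or ji.
pose p x := Num.max (g i x) 0; pose n x := Num.max (- g i x) 0.
have gE x : g i x = p x - n x.
  rewrite /p /n; have [g0|g0] := leP (g i x) 0.
    by rewrite max_l ?oppr_ge0// opprK add0r.
  by rewrite max_r ?subr0// oppr_le0 ltW.
have mp : measurable_fun setT p by exact: measurable_maxr.
have mn : measurable_fun setT n.
  by apply: measurable_maxr => //; exact: measurableT_comp.
have p0 x : 0 <= p x by rewrite le_max lexx orbT.
have n0 x : 0 <= n x by rewrite le_max lexx orbT.
have ip : P.-integrable setT (fun w => (p (X i w))%:E).
  apply: le_integrable (intg i) => //=.
    by apply/measurable_EFinP; apply: measurableT_comp.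
  move=> w _; rewrite lee_fin ger0_norm// /p.
  by rewrite ge_max normr_ge0 andbT ler_norm.
have in_ : P.-integrable setT (fun w => (n (X i w))%:E).
  apply: le_integrable (intg i) => //=.
    by apply/measurable_EFinP; apply: measurableT_comp.
  move=> w _; rewrite lee_fin ger0_norm// /n.
  by rewrite ge_max normr_ge0 andbT -normrN ler_norm.
have [ip' pE] := key _ mp p0 ip.
have [in' nE] := key _ mn n0 in_.
under eq_Rintegral do rewrite (bigD1 i)//= gE mulrBl.
rewrite RintegralB// pE nE -mulrBl [RHS](bigD1 i)//=; congr (_ * _).
by rewrite -RintegralB//; apply: eq_Rintegral => w _; rewrite gE.
Qed.

End independence.

(** * Exponentially tilted Gaussian moments *)

Section normal_moments.
Context {R : realType}.
Local Notation mu := (@lebesgue_measure R).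
Variable s : R.
Hypothesis s0 : s != 0.
Implicit Types (m c x : R) (a n : nat).

(** Completing the square: an exponential tilt translates the Gaussian, and the constant is its
    Laplace transform at c. *)
Lemma expR_normal_pdf m c x :
  expR (- (c * x)) * normal_pdf m s x =
  expR (- (c * m) + c ^+ 2 * s ^+ 2 / 2) * normal_pdf (m - c * s ^+ 2) s x.
Proof.
rewrite !normal_pdfE// /normal_fun mulrCA -expRD [RHS]mulrCA -expRD.
by congr (_ * expR _); field.
Qed.

(** Each exponential dominates the power on one half-line. They are written with c = -1 and c = 1 so
    that [expR_normal_pdf] turns both into translated Gaussians. *)
Lemma normr_exprn_le_expR x a :
  `|x ^+ a| <= a`!%:R * (expR (- (-1 * x)) + expR (- (1 * x))).
Proof.
rewrite mulN1r opprK mul1r normrX.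
have le_abs (y : R) : 0 <= y -> y ^+ a <= a`!%:R * expR y.
  case: a => [|a] y0; first by rewrite expr0 fact0 mul1r -expR0 ler_expR.
  rewrite -ler_pdivrMl ?ltr0n ?fact_gt0// mulrC.
  by rewrite (le_trans _ (expR_ge1Dxn a y0))// lerDr.
rewrite (le_trans (le_abs _ _))// ler_wpM2l//.
by case: ger0P => _; rewrite ?lerDl ?lerDr expR_ge0.
Qed.

Lemma integrable_expR_normal_pdf m c :
  mu.-integrable setT (fun x => (expR (- (c * x)) * normal_pdf m s x)%:E).
Proof.
under eq_fun do rewrite expR_normal_pdf EFinM.
by apply: integrableZl => //; exact: integrable_normal_pdf.
Qed.

Lemma normr_exprn_normal_pdf_le m a x :
  `|x ^+ a * normal_pdf m s x| <=
  a`!%:R * (expR (- (-1 * x)) * normal_pdf m s x +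
            expR (- (1 * x)) * normal_pdf m s x).
Proof.
rewrite normrM (ger0_norm (normal_pdf_ge0 _ _ _)) -mulrDl mulrA.
by rewrite ler_wpM2r ?normal_pdf_ge0// normr_exprn_le_expR.
Qed.

Lemma measurable_exprn_normal_pdf m a :
  measurable_fun setT (fun x => x ^+ a * normal_pdf m s x).
Proof. by apply: measurable_funM => //; exact: measurable_normal_pdf. Qed.

Lemma integrable_exprn_normal_pdf m a :
  mu.-integrable setT (fun x => (x ^+ a * normal_pdf m s x)%:E).
Proof.
pose g c x : R := expR (- (c * x)) * normal_pdf m s x.
have gi : mu.-integrable setT (fun x => (a`!%:R * (g (-1) x + g 1 x))%:E).
  under eq_fun do rewrite EFinM EFinD.
  apply: integrableZl => //.
  by apply: integrableD => //; exact: integrable_expR_normal_pdf.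
apply: le_integrable gi => //.
  by apply/measurable_EFinP; exact: measurable_exprn_normal_pdf.
move=> x _; rewrite !abse_EFin lee_fin.
by rewrite (le_trans (normr_exprn_normal_pdf_le _ _ _))// ler_norm.
Qed.

Lemma exprn_normal_pdf_bounded m a :
  exists2 C, 0 <= C & forall x, `|x ^+ a * normal_pdf m s x| <= C.
Proof.
pose k c := expR (- (c * m) + c ^+ 2 * s ^+ 2 / 2).
exists (a`!%:R * (k (-1) * normal_peak s + k 1 * normal_peak s)).
  by rewrite mulr_ge0// addr_ge0// mulr_ge0 ?expR_ge0 ?normal_peak_ge0.
move=> x; rewrite (le_trans (normr_exprn_normal_pdf_le _ _ _))//.
rewrite ler_wpM2l// lerD// expR_normal_pdf.
  by rewrite ler_wpM2l ?expR_ge0// normal_pdf_ub.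
by rewrite ler_wpM2l ?expR_ge0// normal_pdf_ub.
Qed.

(** The sign [e] treats both ends of the line at once; boundedness one degree higher gives decay of
    order 1 / (n + 1). *)
Lemma cvgn_exprn_normal_pdf m a (e : R) : `|e| = 1 ->
  (e * n.+1%:R) ^+ a * normal_pdf m s (e * n.+1%:R) @[n --> \oo] --> 0.
Proof.
move=> e1; have [C C0 HC] := exprn_normal_pdf_bounded m a.+1.
apply: norm_cvg0.
apply: (@squeeze_cvgr _ _ _ _ (fun=> 0) (fun n => C * n.+1%:R^-1)).
- near=> n; rewrite normr_ge0/= ler_pdivlMr// mulrC.
  apply: le_trans (HC (e * n.+1%:R)).
  by rewrite exprS !normrM e1 mul1r normr_nat mulrA.
- exact: cvg_cst.
- rewrite -(mulr0 C); apply: cvgMr; exact: cvg_harmonic.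
Unshelve. all: by end_near. Qed.

(** The derivative of - s^2 x^a phi(x), where phi is the normal density and phi' = - (x - m) phi /
    s^2. For a = 0 the meaningless power [a.-1] carries the coefficient 0. *)
Definition stein_fun m a x :=
  (x - m) * x ^+ a * normal_pdf m s x -
  s ^+ 2 * a%:R * (x ^+ a.-1 * normal_pdf m s x).

Lemma is_derive_exprn_normal_pdf m a x :
  is_derive x 1 (fun x => - s ^+ 2 * (x ^+ a * normal_pdf m s x))
    (stein_fun m a x).
Proof.
rewrite /stein_fun !normal_pdfE// /normal_fun.
have dq : is_derive x 1 (fun t => - (t - m) ^+ 2 / (s ^+ 2 *+ 2))
    (- (x - m) / s ^+ 2).
  rewrite (_ : (fun t => _) =
      (- (s ^+ 2 *+ 2)^-1) \*: ((id - cst m) ^+ 2 : R -> R)); last first.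
    by apply/funext => t /=; rewrite mulrC mulrN -mulNr.
  apply: is_derive_eq; rewrite /= !subr0 /GRing.scale/= mulr1.
  by rewrite expr1 -[(id - cst m) x]/(x - m); field.
have de := is_derive1_comp (is_derive_expR _) dq.
rewrite (_ : (fun t => _) = (- s ^+ 2 * normal_peak s) \*:
    ((id ^+ a : R -> R) *
     (expR \o (fun t => - (t - m) ^+ 2 / (s ^+ 2 *+ 2))))); last first.
  by apply/funext => t /=; rewrite /GRing.scale/= fctE/= fctE; ring.
apply: is_derive_eq; rewrite /= /GRing.scale/=.
rewrite (_ : (id ^+ a : R -> R) x = x ^+ a); last by rewrite exprfctE.
by field.
Qed.

Lemma integrable_stein_fun m a :
  mu.-integrable setT (EFin \o stein_fun m a).
Proof.
rewrite (_ : _ \o _ = (fun x => (x ^+ a.+1 * normal_pdf m s x)%:E -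
    (m%:E * (x ^+ a * normal_pdf m s x)%:E +
    (s ^+ 2 * a%:R)%:E * (x ^+ a.-1 * normal_pdf m s x)%:E))%E); last first.
  apply/funext => x; rewrite -!EFinM -EFinD; congr EFin.
  by rewrite /stein_fun (exprS x); ring.
apply: integrableB => //; first exact: integrable_exprn_normal_pdf.
by apply: integrableD => //; apply: integrableZl => //;
  exact: integrable_exprn_normal_pdf.
Qed.

Lemma continuous_stein_fun m a : continuous (stein_fun m a).
Proof.
move=> x; have cX b : {for x, continuous (fun y : R => y ^+ b)}.
  exact: exprn_continuous.
have cpdf : {for x, continuous (normal_pdf m s)} by exact: continuous_normal_pdf.
apply: cvgB; apply: cvgM => //.
- apply: cvgM; last exact: cX.
  by apply: cvgB; [exact: cvg_id|exact: cvg_cst].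
- exact: cvg_cst.
- by apply: cvgM => //; exact: cX.
Qed.

(** The fundamental theorem of calculus on [-(n + 1), n + 1] leaves boundary values that tend to 0;
    dominated convergence identifies the limit with the integral over the line. *)
Lemma integral_stein_fun m a : \int[mu]_x stein_fun m a x = 0.
Proof.
pose F x := - s ^+ 2 * (x ^+ a * normal_pdf m s x).
pose D n := `[(- n.+1%:R : R), n.+1%:R]%classic.
have FTC n : (\int[mu]_(x in D n) (stein_fun m a x)%:E =
    (F n.+1%:R - F (- n.+1%:R))%:E)%E.
  have dF x : is_derive x 1 F (stein_fun m a x).
    exact: is_derive_exprn_normal_pdf.
  have cF : continuous F.
    by move=> x; apply/differentiable_continuous/derivable1_diffP; exact: ex_derive.
  rewrite EFinB /D (@continuous_FTC2 _ (stein_fun m a) F)//.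
  - by rewrite gtrN.
  - by apply: continuous_subspaceT => x; exact: continuous_stein_fun.
  - split => [x _||]; first exact: ex_derive.
      by apply/cvg_at_right_filter; exact: cF.
    by apply/cvg_at_left_filter; exact: cF.
  - by move=> x _; rewrite derive1E derive_val.
have F0 (e : R) : `|e| = 1 -> F (e * n.+1%:R) @[n --> \oo] --> 0.
  move=> e1; rewrite -(mulr0 (- s ^+ 2)); apply: cvgMr.
  exact: cvgn_exprn_normal_pdf.
have lim0 : (\int[mu]_(x in D n) (stein_fun m a x)%:E @[n --> \oo] --> 0)%E.
  under eq_fun do rewrite FTC.
  have dF0 : F n.+1%:R - F (- n.+1%:R) @[n --> \oo] --> 0.
    rewrite -[X in _ --> X](subrr 0); apply: cvgB.
      have := F0 1; rewrite normr1; under eq_fun do rewrite mul1r.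
      exact.
    have := F0 (- 1); rewrite normrN1; under eq_fun do rewrite mulN1r.
    exact.
  exact: cvg_comp dF0 _.
have mf : measurable_fun setT (EFin \o stein_fun m a).
  exact: measurable_int (integrable_stein_fun m a).
have mfD n : measurable_fun setT ((EFin \o stein_fun m a) \_ (D n)).
  apply/(measurable_restrictT (EFin \o stein_fun m a)); first exact: measurable_itv.
  exact: measurable_funTS.
have cvD x : ((EFin \o stein_fun m a) \_ (D n)) x @[n --> \oo] -->
    (EFin \o stein_fun m a) x.
  apply: cvg_near_cst; near=> n.
  rewrite patchE mem_set//; rewrite /D/= in_itv/= -ler_norml ltW//.
  rewrite (@lt_trans _ _ n%:R) ?ltr_nat//.
  by near: n; exact: nbhs_infty_gtr.
have leD x n : (`|((EFin \o stein_fun m a) \_ (D n)) x| <=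
    (abse \o (EFin \o stein_fun m a)) x)%E.
  by rewrite patchE; case: ifP => // _; rewrite abse0; exact: abse_ge0.
have [_ _ cv] := @dominated_convergence _ _ _ mu setT measurableT _ _ _ mfD mf
  (aeW mu (fun x _ => cvD x)) (integrable_abse (integrable_stein_fun m a))
  (aeW mu (fun x n _ => leD x n)).
rewrite /Rintegral -(cvg_lim _ cv)//.
under eq_fun do rewrite -integral_mkcond.
by rewrite (cvg_lim _ lim0).
Unshelve. all: by end_near. Qed.

(** Stein's identity on monomials: the vanishing integral of [stein_fun] is solved for its term of
    highest degree. *)
Lemma Rintegral_exprS_normal_pdf m a :
  \int[mu]_x (x ^+ a.+1 * normal_pdf m s x) =
  m * (\int[mu]_x (x ^+ a * normal_pdf m s x)) +
  s ^+ 2 * a%:R * \int[mu]_x (x ^+ a.-1 * normal_pdf m s x).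
Proof.
have i1 := integrable_exprn_normal_pdf m a.
have i2 := integrable_exprn_normal_pdf m a.-1.
rewrite -!RintegralZl// -[LHS]subr0 -[X in _ - X](integral_stein_fun m a).
rewrite -RintegralB//; [|exact: integrable_exprn_normal_pdf|
  exact: integrable_stein_fun].
rewrite -RintegralD//; last 2 first.
- exact: (integrableZl measurableT _ i1).
- exact: (integrableZl measurableT _ i2).
by apply: eq_Rintegral => x _; rewrite /stein_fun (exprS x); ring.
Qed.

(** * Transfer from the normal density to normal random variables *)

Section normal_RV.
Context d (T : measurableType d) (P : probability T R) (X : {RV P >-> R}).
Variable m : R.
Hypothesis X_normal : normal_RV X m s.

Lemma ge0_integral_normal_RV (f : R -> R) :
  measurable_fun setT f -> (forall x, 0 <= f x) ->
  (\int[P]_w (f (X w))%:E = \int[mu]_x (f x * normal_pdf m s x)%:E)%E.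
Proof.
move=> mf f0.
transitivity (\int[P]_w (cst 1 w * f (X w))%:E)%E.
  by apply: eq_integral => w _; rewrite /= mul1r.
rewrite (@ge0_integral_comp_eq _ _ _ _ _ _ _ P mu X id (cst 1)
  (normal_pdf m s) f)//.
- by apply: eq_integral => x _; rewrite mulrC.
- exact: measurable_normal_pdf.
- exact: normal_pdf_ge0.
move=> A mA.
transitivity (distribution P X A).
  under eq_integral do rewrite mul1r.
  rewrite (@integral_indic _ _ _ P _ measurableT (X @^-1` A)) ?setIT//.
  exact: measurable_funPTI.
rewrite X_normal// /normal_prob [LHS]integral_mkcond.
apply: eq_integral => x _; rewrite patchE indicE.
by case: ifPn => _; rewrite ?mulr1 ?mulr0.
Qed.

Lemma integrable_normal_RV (f : R -> R) : measurable_fun setT f ->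
  mu.-integrable setT (fun x => (f x * normal_pdf m s x)%:E) ->
  P.-integrable setT (fun w => (f (X w))%:E).
Proof.
move=> mf /integrableP[_ intf]; apply/integrableP; split.
  by apply/measurable_EFinP; apply: measurableT_comp.
rewrite (le_lt_trans _ intf)//.
rewrite (@ge0_integral_normal_RV (fun x => `|f x|)) //; last first.
  exact: measurableT_comp.
rewrite le_eqVlt; apply/orP; left; apply/eqP; apply: eq_integral => x _.
by rewrite abse_EFin normrM (ger0_norm (normal_pdf_ge0 _ _ _)).
Qed.

Lemma Rintegral_normal_RV (f : R -> R) : measurable_fun setT f ->
  \int[P]_w f (X w) = \int[mu]_x (f x * normal_pdf m s x).
Proof.
move=> mf; rewrite /Rintegral integralE [in RHS]integralE.
congr (fine (_ - _)).
- transitivity (\int[P]_w (Num.max (f (X w)) 0)%:E)%E.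
    by apply: eq_integral => w _; rewrite funeposE EFin_max.
  rewrite (@ge0_integral_normal_RV (fun x => Num.max (f x) 0)).
  + apply: eq_integral => x _; rewrite funeposE -EFin_max.
    by rewrite maxr_pMl ?normal_pdf_ge0// mul0r.
  + exact: measurable_maxr.
  + by move=> x; rewrite le_max lexx orbT.
- transitivity (\int[P]_w (Num.max (- f (X w)) 0)%:E)%E.
    by apply: eq_integral => w _; rewrite funenegE EFin_max.
  rewrite (@ge0_integral_normal_RV (fun x => Num.max (- f x) 0)).
  + apply: eq_integral => x _; rewrite funenegE -EFinN -EFin_max.
    by rewrite maxr_pMl ?normal_pdf_ge0// mul0r mulNr.
  + by apply: measurable_maxr => //; exact: measurableT_comp.
  + by move=> x; rewrite le_max lexx orbT.
Qed.

(** The contribution of one variable to exp(- c sum_k X_k) times a monomial; the weighted monomial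
    is the product of these over independent variables. *)
Definition tilted_monomial c a x : R := expR (- (c * x)) * x ^+ a.

Lemma measurable_tilted_monomial c a :
  measurable_fun setT (tilted_monomial c a).
Proof.
apply: measurable_funM => //; apply: measurableT_comp => //.
by apply: measurableT_comp => //; exact: measurable_funM.
Qed.

Let tilted_monomialE c a x :
  tilted_monomial c a x * normal_pdf m s x =
  expR (- (c * m) + c ^+ 2 * s ^+ 2 / 2) *
    (x ^+ a * normal_pdf (m - c * s ^+ 2) s x).
Proof. by rewrite /tilted_monomial mulrAC expR_normal_pdf mulrA mulrAC. Qed.

Lemma integrable_tilted_monomial c a :
  P.-integrable setT (fun w => (tilted_monomial c a (X w))%:E).
Proof.
apply: (integrable_normal_RV (measurable_tilted_monomial c a)).
under eq_fun do rewrite tilted_monomialE EFinM.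
by apply: integrableZl => //; exact: integrable_exprn_normal_pdf.
Qed.

Lemma Rintegral_tilted_monomial c a :
  \int[P]_w tilted_monomial c a (X w) =
  expR (- (c * m) + c ^+ 2 * s ^+ 2 / 2) *
    \int[mu]_x (x ^+ a * normal_pdf (m - c * s ^+ 2) s x).
Proof.
rewrite Rintegral_normal_RV; last exact: measurable_tilted_monomial.
under eq_Rintegral do rewrite tilted_monomialE.
by rewrite RintegralZl//; exact: integrable_exprn_normal_pdf.
Qed.

Lemma Rintegral_tilted_monomial0 c :
  \int[P]_w tilted_monomial c 0 (X w) =
  expR (- (c * m) + c ^+ 2 * s ^+ 2 / 2).
Proof.
rewrite Rintegral_tilted_monomial.
under eq_Rintegral do rewrite expr0 mul1r.
by rewrite /Rintegral integral_normal_pdf mulr1.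
Qed.

Lemma Rintegral_tilted_monomialS c a :
  \int[P]_w tilted_monomial c a.+1 (X w) =
  (m - c * s ^+ 2) * (\int[P]_w tilted_monomial c a (X w)) +
  s ^+ 2 * a%:R * \int[P]_w tilted_monomial c a.-1 (X w).
Proof.
by rewrite !Rintegral_tilted_monomial Rintegral_exprS_normal_pdf; ring.
Qed.

End normal_RV.
End normal_moments.

(** * Stein's identity and the sum of squared deviations *)

Section mpoly_deviation.
Context {R : realType} (K : nat).
Hypothesis K0 : (0 < K)%N.
Local Notation poly := (mpoly K R).
Implicit Types (k j : 'I_K) (p : poly).

(** The sample is modelled by formal variables, so that partial derivatives are algebraic and
    Stein's identity can be verified on monomials. *)
Definition mvar k : poly := mpolyX R (mnm1 k).
Definition mmean : poly := K%:R^-1 *: \sum_k mvar k.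
Definition mdev k : poly := mvar k - mmean.
Definition msqdev : poly := \sum_k mdev k ^+ 2.

Lemma mderivXn k p n :
  mderiv k (p ^+ n) = n%:R * p ^+ n.-1 * mderiv k p.
Proof.
elim: n => [|n ih]; first by rewrite expr0 mulr0n !mul0r -[1]/(mpolyC K 1) mderivC.
rewrite exprS mderivM ih /= -natr1; case: n {ih} => [|n] /=.
  by rewrite !mul0r expr0; ring.
by rewrite exprS; ring.
Qed.

Lemma mderiv_mvar k j : mderiv k (mvar j) = (j == k)%:R.
Proof.
rewrite /mvar mderivX mnm1E eq_sym; case: eqP => [->|_]; last by rewrite scale0r.
rewrite scale1r -(mpolyX0 K R); congr mpolyX.
by apply/mnmP => i; rewrite mnmBE mnm0E subnn.
Qed.

Lemma mderiv_mmean k : mderiv k mmean = (K%:R^-1)%:A.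
Proof.
rewrite /mmean mderivZ; congr (_ *: _).
rewrite raddf_sum/= (bigD1 k)//= mderiv_mvar eqxx big1 ?addr0// => j /negbTE jk.
by rewrite mderiv_mvar jk.
Qed.

Lemma sum_mdev : \sum_k mdev k = 0.
Proof.
rewrite /mdev sumrB sumr_const card_ord /mmean -scaler_nat scalerA.
by rewrite mulfV ?scale1r ?subrr// pnatr_eq0 -lt0n.
Qed.

Lemma mderiv_mdev k j : mderiv k (mdev j) = (j == k)%:R - (K%:R^-1)%:A.
Proof. by rewrite /mdev mderivB mderiv_mvar mderiv_mmean. Qed.

(** The derivative 1 / K of the mean contributes a multiple of the sum of the deviations, which is
    0. *)
Lemma mderiv_msqdev k : mderiv k msqdev = 2 * mdev k.
Proof.
rewrite /msqdev raddf_sum/=.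
under eq_bigr do rewrite mderivXn mderiv_mdev mulrBr.
rewrite sumrB -mulr_suml -mulr_sumr sum_mdev mulr0 mul0r subr0.
rewrite (bigD1 k)//= eqxx mulr1 expr1 big1 ?addr0// => j /negbTE ->.
by rewrite mulr0.
Qed.

(** One factor of each square may be recentred at any constant, since the change multiplies the sum
    of the deviations. This produces the products to which Stein's identity applies. *)
Lemma msqdevE (c : R) : msqdev = \sum_k (mvar k - c%:A) * mdev k.
Proof.
under [RHS]eq_bigr => k _.
  rewrite (_ : mvar k - c%:A = mdev k + (mmean - c%:A)); last first.
    by rewrite /mdev addrA subrK.
  rewrite mulrDl -expr2.
  over.
by rewrite big_split/= -mulr_sumr sum_mdev mulr0 addr0.
Qed.

(** The K derivatives of the deviations, each 1 - 1 / K, add up to K - 1; differentiating the power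
    yields 2 n, because the sum of [mdev k * (2 * mdev k)] is [2 * msqdev]. *)
Lemma sum_mderiv_mdev_msqdev n :
  \sum_k mderiv k (mdev k * msqdev ^+ n) = (K%:R - 1 + 2 * n%:R) *: msqdev ^+ n.
Proof.
under eq_bigr do rewrite mderivM mderiv_mdev eqxx mderivXn mderiv_msqdev.
rewrite big_split/= sumr_const card_ord.
have -> : \sum_k mdev k * (n%:R * msqdev ^+ n.-1 * (2 * mdev k)) =
    2 * n%:R * msqdev ^+ n.
  transitivity (\sum_k 2 * n%:R * msqdev ^+ n.-1 * mdev k ^+ 2).
    by apply: eq_bigr => k _; ring.
  rewrite -mulr_sumr -/msqdev; case: n => [|n]; first by rewrite mulr0 !mul0r.
  by rewrite /= -mulrA -exprSr.
rewrite -[RHS]mulr_algl.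
have -> : (K%:R - 1 + 2 * n%:R)%:A = K%:R - 1 + 2 * n%:R :> poly.
  by rewrite -[LHS]/(in_alg _ _) rmorphD rmorphB rmorphM !rmorph_nat rmorph1.
rewrite -mulr_natl.
transitivity (K%:R * msqdev ^+ n - (K%:R * (K%:R^-1)%:A) * msqdev ^+ n +
  2 * n%:R * msqdev ^+ n); first by ring.
have -> : K%:R * (K%:R^-1)%:A = 1 :> poly.
  by rewrite mulr_natl -scaler_nat scalerA mulfV ?scale1r// pnatr_eq0 -lt0n.
by ring.
Qed.

(* Stein's identity [E ((x_k - c) p) = v * E (d_k p)] alone determines the
   moments of the sum of squared deviations. *)
Lemma stein_msqdev (E : poly -> R) (c v : R) :
  (forall a p q, E (a *: p + q) = a * E p + E q) ->
  (forall k p, E ((mvar k - c%:A) * p) = v * E (mderiv k p)) ->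
  forall n, E (msqdev ^+ n) = (\prod_(i < n) (v * (K%:R - 1 + 2 * i%:R))) * E 1.
Proof.
move=> Elin stein.
have E0 : E 0 = 0.
  by have := Elin 1 0 0; rewrite scale1r addr0 mul1r -[LHS]addr0 => /addrI.
have ED p q : E (p + q) = E p + E q by rewrite -[p]scale1r Elin mul1r scale1r.
have EZ a p : E (a *: p) = a * E p by rewrite -[a *: p]addr0 Elin E0 addr0.
have Esum (F : 'I_K -> poly) : E (\sum_k F k) = \sum_k E (F k).
  by elim/big_ind2 : _ => // x1 x2 y1 y2 <- <-.
elim=> [|n ih]; first by rewrite expr0 big_ord0 mul1r.
rewrite exprS {1}(msqdevE c) mulr_suml Esum.
under eq_bigr do rewrite -mulrA stein.
rewrite -mulr_sumr -Esum sum_mderiv_mdev_msqdev EZ ih big_ord_recr/=.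
by ring.
Qed.

Lemma meval_msqdev (v : 'I_K -> R) :
  meval v msqdev = \sum_k (v k - sample_mean v) ^+ 2.
Proof.
rewrite raddf_sum/=; apply: eq_bigr => k _.
by rewrite rmorphXn/= mevalB mevalXU mevalZ raddf_sum/=;
  under eq_bigr do rewrite mevalXU.
Qed.

End mpoly_deviation.

(** * Weighted expectations of polynomials in the sample *)

Section tilted_moments.
Context d (T : measurableType d) (R : realType) (P : probability T R) (K : nat).
Variables (X : 'I_K -> {RV P >-> R}) (l s c : R).
Hypotheses (K0 : (0 < K)%N) (s0 : s != 0) (X_indep : independent_RVs X)
  (X_normal : forall k, normal_RV (X k) l s).
Local Notation poly := (mpoly K R).
Implicit Types (k : 'I_K) (p q : poly) (m : multinom K).

Let W w : R := expR (- (c * \sum_k X k w)).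
Let ev p w : R := W w * meval (X^~ w) p.

Let ev_monomial m w :
  ev (mpolyX R m) w = \prod_k tilted_monomial c (m k) (X k w).
Proof.
by rewrite /ev /W mevalX mulr_sumr -sumrN expR_sum -big_split.
Qed.

Let ev_lin a p q w : ev (a *: p + q) w = a * ev p w + ev q w.
Proof. by rewrite /ev mevalD mevalZ mulrDr mulrCA. Qed.

Let integrable_monomial m : P.-integrable setT (fun w => (ev (mpolyX R m) w)%:E).
Proof.
under eq_fun do rewrite ev_monomial.
apply: (integrable_prod X_indep
  (f := fun k => tilted_monomial c (m k))) => k; first exact: measurable_tilted_monomial.
exact: (integrable_tilted_monomial s0 (X_normal k)).
Qed.

Lemma integrable_tilted_meval p : P.-integrable setT (fun w => (ev p w)%:E).
Proof.
elim/mpolyind: p => [|a m p _ _ ih].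
  by under eq_fun do rewrite /ev meval0 mulr0; exact: integrable0.
under eq_fun do rewrite ev_lin EFinD EFinM.
by apply: integrableD => //; apply: integrableZl.
Qed.

Definition tilted_expectation p := \int[P]_w ev p w.

Lemma tilted_expectation_lin a p q :
  tilted_expectation (a *: p + q) = a * tilted_expectation p + tilted_expectation q.
Proof.
rewrite /tilted_expectation; under eq_Rintegral do rewrite ev_lin.
have ip := integrable_tilted_meval p.
rewrite RintegralD//; first by rewrite RintegralZl.
  exact: (integrableZl measurableT _ ip).
exact: integrable_tilted_meval.
Qed.

Lemma tilted_expectation_monomial m :
  tilted_expectation (mpolyX R m) =
  \prod_k \int[P]_w tilted_monomial c (m k) (X k w).
Proof.
rewrite /tilted_expectation; under eq_Rintegral do rewrite ev_monomial.
rewrite (Rintegral_prod X_indep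
  (f := fun k => tilted_monomial c (m k)))// => k; first exact: measurable_tilted_monomial.
exact: (integrable_tilted_monomial s0 (X_normal k)).
Qed.

Lemma tilted_expectation1 :
  tilted_expectation 1 = expR (K%:R * (- (c * l) + c ^+ 2 * s ^+ 2 / 2)).
Proof.
rewrite -(mpolyX0 K R) tilted_expectation_monomial.
under eq_bigr => k _ do rewrite mnm0E (Rintegral_tilted_monomial0 s0 (X_normal k)).
by rewrite prodr_const card_ord -expRM_natl.
Qed.

(** Linearity reduces to monomials, where independence isolates the factor of index [k]; the
    recursion of [Rintegral_tilted_monomialS] for that single factor is then the claim. *)
Lemma tilted_expectation_stein k p :
  tilted_expectation ((mvar k - (l - c * s ^+ 2)%:A) * p) =
  s ^+ 2 * tilted_expectation (mderiv k p).
Proof.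
have TD p1 p2 : tilted_expectation (p1 + p2) =
    tilted_expectation p1 + tilted_expectation p2.
  by rewrite -[p1]scale1r tilted_expectation_lin mul1r scale1r.
have T0 : tilted_expectation 0 = 0.
  by have := TD 0 0; rewrite addr0 -[LHS]addr0 => /addrI.
have TZ a p1 : tilted_expectation (a *: p1) = a * tilted_expectation p1.
  by rewrite -[a *: p1]addr0 tilted_expectation_lin T0 addr0.
elim/mpolyind: p => [|a m p _ _ ih].
  by rewrite mulr0 mderiv0 T0 mulr0.
rewrite mulrDr TD ih mderivD TD mulrDr mderivZ -scalerAr !TZ.
congr (_ + _); rewrite [RHS]mulrCA; congr (_ * _).
rewrite mulrBl -scaleN1r TD TZ mulr_algl TZ /mvar -mpolyXD mderivX TZ.
rewrite !tilted_expectation_monomial.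
rewrite [in LHS](bigD1 k)//= [X in _ * (_ * X)](bigD1 k)//=.
have -> : \prod_(i < K | i != k)
    \int[P]_w tilted_monomial c (mnm_add (mnm1 k) m i) (X i w) =
    \prod_(i < K | i != k) \int[P]_w tilted_monomial c (m i) (X i w).
  by apply: eq_bigr => i ik; rewrite mnmDE mnm1E eq_sym (negbTE ik) add0n.
(* If [m k] is 0, the truncated subtraction and [(m k).-1] both give 0, and the term carries the
   coefficient [m k]. *)
have -> : \prod_(k0 < K)
      \int[P]_w tilted_monomial c (mnm_sub m (mnm1 k) k0) (X k0 w) =
    (\int[P]_w tilted_monomial c (m k).-1 (X k w)) *
    \prod_(i < K | i != k) \int[P]_w tilted_monomial c (m i) (X i w).
  rewrite (bigD1 k)//= mnmBE mnm1E eqxx subn1; congr (_ * _).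
  by apply: eq_bigr => i ik; rewrite mnmBE mnm1E eq_sym (negbTE ik) subn0.
rewrite mnmDE mnm1E eqxx add1n (Rintegral_tilted_monomialS s0 (X_normal k)).
by ring.
Qed.

Let Q w := \sum_k (X k w - sample_mean (X^~ w)) ^+ 2.

Let ev_msqdev n w : ev (@msqdev R K ^+ n) w = W w * Q w ^+ n.
Proof. by rewrite /ev rmorphXn/= meval_msqdev. Qed.

Lemma integrable_tilted_sqdev n :
  P.-integrable setT (fun w => (W w * Q w ^+ n)%:E).
Proof. by under eq_fun do rewrite -ev_msqdev; exact: integrable_tilted_meval. Qed.

Lemma Rintegral_tilted_sqdev n :
  \int[P]_w (W w * Q w ^+ n) =
  (\prod_(i < n) (s ^+ 2 * (K%:R - 1 + 2 * i%:R))) *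
  expR (K%:R * (- (c * l) + c ^+ 2 * s ^+ 2 / 2)).
Proof.
under eq_Rintegral do rewrite -ev_msqdev.
rewrite -tilted_expectation1.
exact: (stein_msqdev K0 tilted_expectation_lin tilted_expectation_stein).
Qed.

End tilted_moments.

(** Dominated convergence of the partial sums; the majorant is the sum of the absolute values,
    integrable by exchanging sum and integral of nonnegative terms. *)
Lemma cvg_integral_series d (T : measurableType d) (R : realType)
    (mu : {measure set T -> \bar R}) (f : nat -> T -> R) (F : T -> R) :
  (forall n, measurable_fun setT (f n)) ->
  (\sum_(n <oo) \int[mu]_x `|f n x|%:E < +oo)%E ->
  (forall x, series (f ^~ x) n @[n --> \oo] --> F x) ->
  (\int[mu]_x (series (f ^~ x) n)%:E @[n --> \oo] --> \int[mu]_x (F x)%:E)%E.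
Proof.
move=> mf sumf cvF.
pose g x := (\sum_(n <oo) `|f n x|%:E)%E.
have mabs n : measurable_fun setT (fun x => `|f n x|%:E).
  by apply/measurable_EFinP; exact: measurableT_comp.
have mg : measurable_fun setT g.
  by apply: ge0_emeasurable_sum => // n x _ _; rewrite lee_fin.
have g0 x : (0 <= g x)%E by apply: nneseries_ge0 => n _ _; rewrite lee_fin.
have intg : mu.-integrable setT g.
  apply/integrableP; split => //.
  under eq_integral do rewrite gee0_abs//.
  by rewrite integral_nneseries// => n x _; rewrite lee_fin.
have mS n : measurable_fun setT (fun x => (series (f ^~ x) n)%:E).
  by apply/measurable_EFinP; exact: measurable_sum.
have cvS x : (series (f ^~ x) n)%:E @[n --> \oo] --> (F x)%:E.
  exact: cvg_comp (cvF x) _.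
have leS x n : (`|(series (f ^~ x) n)%:E| <= g x)%E.
  apply: le_trans (nneseries_lim_ge n _); last by move=> k _ _; rewrite lee_fin.
  by rewrite sumEFin abse_EFin lee_fin ler_norm_sum.
have mF : measurable_fun setT (fun x => (F x)%:E).
  by apply: emeasurable_fun_cvg mS _ => x _; exact: cvS.
have [_ _] := @dominated_convergence _ _ _ mu setT measurableT _ _ _ mS mF
  (aeW mu (fun x _ => cvS x)) intg (aeW mu (fun x n _ => leS x n)).
exact.
Qed.

(** * The Bessel factor as a power series *)

Section bessel_series.
Context {R : realType}.
Implicit Types (a y : R) (n K : nat).

(* The modulus of the [n]-th term of the series of
   [Gamma(a) (z/2)^(1 - a) J_(a - 1)(z)], where [y] is [(z/2)^2]. *)
Definition bessel_term a y n : R :=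
  y ^+ n / (n`!%:R * \prod_(i < n) (i%:R + a)).

Lemma bessel_term_ge0 a y n : 0 < a -> 0 <= y -> 0 <= bessel_term a y n.
Proof.
move=> a0 y0; rewrite divr_ge0 ?exprn_ge0// mulr_ge0// prodr_ge0// => i _.
by rewrite addr_ge0// ltW.
Qed.

(** Every factor i + a of the denominator is at least 1 / 2, so the terms are dominated by (2 y)^n /
    n!, those of an exponential series. The bound on a corresponds to K >= 2. *)
Lemma is_cvg_series_bessel_term a y : 2^-1 <= a -> 0 <= y ->
  cvgn (series (fun n => (-1) ^+ n * bessel_term a y n)).
Proof.
move=> a2 y0; have a0 : 0 < a by exact: lt_le_trans a2.
apply: normed_cvg.
rewrite (_ : [normed series _] = series (bessel_term a y)); last first.
  apply/funext => N; apply: eq_bigr => n _.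
  by rewrite /= normrM normrX normrN1 expr1n mul1r ger0_norm// bessel_term_ge0.
apply: series_le_cvg (is_cvg_series_exp_coeff (2 * y)) => n.
- exact: bessel_term_ge0.
- by rewrite exp_coeff_ge0// mulr_ge0.
rewrite /bessel_term /exp_coeff/= exprMn mulrC invfM -mulrA [leRHS]mulrC.
rewrite ler_wpM2l ?invr_ge0// ler_wpM2r ?exprn_ge0//.
rewrite -[leRHS]invrK -exprVn lef_pV2 ?posrE ?exprn_gt0 ?prodr_gt0//; last first.
  by move=> i _; rewrite ltr_wpDl.
rewrite -[n in leLHS]card_ord -prodr_const; apply: ler_prod => i _.
by rewrite invr_ge0 ler0n/=; apply: le_trans a2 _; rewrite lerDr.
Qed.

Lemma cvg_series_bessel_factor (beta s2 : R) K :
  (2 <= K)%N -> 0 <= beta -> 0 <= s2 ->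
  series (fun n => (-1) ^+ n * bessel_term ((K%:R - 1) / 2)
    (beta ^+ 2 * ((K%:R - 1) * s2 / K%:R) / 4) n) n @[n --> \oo] -->
  bessel_factor beta s2 K.
Proof.
move=> K2 beta0 s20; set a := _ / 2; set y := _ / 4.
have K1 : 1 <= K%:R - 1 :> R.
  by rewrite lerBrDr -[leLHS]/(2%:R) ler_nat.
have a2 : 2^-1 <= a by rewrite -[leLHS]mul1r ler_wpM2r.
have a0 : 0 < a by exact: lt_le_trans a2.
have r0 : 0 <= (K%:R - 1) * s2 / K%:R.
  by rewrite divr_ge0// mulr_ge0// (le_trans _ K1).
have y0 : 0 <= y by rewrite divr_ge0// mulr_ge0// sqr_ge0.
have cv := is_cvg_series_bessel_term a2 y0.
set z := bessel_arg beta s2 K.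
have yE : y = (z / 2) ^+ 2.
  by rewrite /z /bessel_arg expr_div_n exprMn sqr_sqrtr// /y -natrX.
rewrite /bessel_factor -/z; case: ifPn => [z0|]; last first.
  rewrite -leNgt => z0.
  have z_0 : z = 0 by apply/le_anti; rewrite z0 mulr_ge0 ?sqrtr_ge0.
  (* At z = 0 only the term of index 0 survives, and it equals 1; the partial sums are constant once
     they include it, that is from n = 1 on. *)
  apply: cvg_near_cst; near=> n.
  have n0 : (0 < n)%N by near: n; exact: nbhs_infty_gt.
  rewrite /series/= big_mkord -(prednK n0) big_ord_recl/= big1 ?addr0.
    by rewrite /bessel_term !expr0 fact0 big_ord0 !mul1r invr1.
  by move=> i _; rewrite /bessel_term yE z_0 mul0r expr0n/= expr0n mul0r mulr0.
have nuE : bessel_order R K + 1 = a by rewrite /bessel_order /a; field.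
have z20 : 0 < z / 2 by rewrite divr_gt0.
(* The prefactor of the Bessel function in the Bessel factor; its inverse comes out of every term of
   J once Gamma(n + a) is written as a rising factorial times Gamma(a). *)
pose C := Gamma a * (z / 2) `^ (- bessel_order R K).
have C0 : C != 0 by rewrite mulf_neq0// gt_eqF ?Gamma_gt0// powR_gt0.
have termE n :
    (-1) ^+ n / (n`!%:R * Gamma (n%:R + bessel_order R K + 1)) *
      (z / 2) `^ (2 * n%:R + bessel_order R K) =
    C^-1 * ((-1) ^+ n * bessel_term a y n).
  rewrite -addrA nuE GammaDn// powRD; last by rewrite (gt_eqF z20) implybT.
  rewrite (_ : 2 * n%:R = (2 * n)%:R); last by rewrite natrM.
  rewrite powR_mulrn ?(ltW z20)// exprM -yE /bessel_term /C powRN.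
  have G0 : Gamma a != 0 by rewrite gt_eqF ?Gamma_gt0.
  have p0 : (z / 2) `^ bessel_order R K != 0 by rewrite gt_eqF ?powR_gt0.
  have f0 : n`!%:R != 0 :> R by rewrite pnatr_eq0 -lt0n fact_gt0.
  have q0 : \prod_(i < n) (i%:R + a) != 0.
    by rewrite prodf_seq_neq0; apply/allP => i _ /=; rewrite gt_eqF// ltr_wpDl.
  by field; rewrite G0 p0 f0 q0.
rewrite nuE -/C /besselJ (eq_fun termE).
rewrite (_ : limn _ =
    C^-1 * limn (series (fun n => (-1) ^+ n * bessel_term a y n))).
  by rewrite mulrA mulfV// mul1r.
exact: (lim_seriesZ C^-1 cv).
Unshelve. all: by end_near. Qed.

End bessel_series.

(** * Termwise integration *)

Section tilted_bessel.
Context d (T : measurableType d) (R : realType) (P : probability T R) (K : nat).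
Variables (X : 'I_K -> {RV P >-> R}) (l s c beta : R).
Hypotheses (K2 : (2 <= K)%N) (s0 : s != 0) (X_indep : independent_RVs X)
  (X_normal : forall k, normal_RV (X k) l s) (beta0 : 0 <= beta).

(** The n-th term has weighted mean C (- la)^n / n!. The absolute values sum to C exp(la), which
    justifies termwise integration, and the signed series sums to C exp(- la). *)
Lemma integral_tilted_bessel_factor :
  (\int[P]_w (expR (- (c * \sum_k X k w)) *
     bessel_factor beta (sample_var (X^~ w)) K)%:E =
   (expR (K%:R * (- (c * l) + c ^+ 2 * s ^+ 2 / 2) -
          beta ^+ 2 * s ^+ 2 / (2 * K%:R)))%:E)%E.
Proof.
have K0 : (0 < K)%N by exact: ltn_trans K2.
have KR : K%:R != 0 :> R by rewrite pnatr_eq0 -lt0n.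
have K1 : 0 < K%:R - 1 :> R by rewrite subr_gt0 ltr1n.
pose W w := expR (- (c * \sum_k X k w)).
pose Q w := \sum_k (X k w - sample_mean (X^~ w)) ^+ 2.
pose C : R := expR (K%:R * (- (c * l) + c ^+ 2 * s ^+ 2 / 2)).
pose a : R := (K%:R - 1) / 2.
have a0 : 0 < a by rewrite divr_gt0.
pose la := beta ^+ 2 * s ^+ 2 / (2 * K%:R).
have la0 : 0 <= la by rewrite divr_ge0// mulr_ge0// sqr_ge0.
(* This is (z / 2)^2 at the sample variance; the factor K - 1 undoes the normalisation of the
   variance, which makes it a multiple of Q. *)
pose y w := beta ^+ 2 * ((K%:R - 1) * sample_var (X^~ w) / K%:R) / 4.
have yE w : y w = beta ^+ 2 / (4 * K%:R) * Q w.
  by rewrite /y /sample_var -/(Q w); field; rewrite KR gt_eqF.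
have Q0 w : 0 <= Q w by apply: sumr_ge0 => k _; exact: sqr_ge0.
have y0 w : 0 <= y w by rewrite yE mulr_ge0// divr_ge0// sqr_ge0.
pose k0 n := (beta ^+ 2 / (4 * K%:R)) ^+ n / (n`!%:R * \prod_(i < n) (i%:R + a)).
have WtE n w : W w * bessel_term a (y w) n = k0 n * (W w * Q w ^+ n).
  by rewrite /bessel_term yE exprMn /k0; ring.
have inW n : P.-integrable setT (fun w => (W w * Q w ^+ n)%:E).
  exact: (integrable_tilted_sqdev _ s0 X_indep X_normal).
have momE n : (\int[P]_w (W w * bessel_term a (y w) n)%:E =
    (C * exp_coeff la n)%:E)%E.
  under eq_integral do rewrite WtE EFinM.
  rewrite integralZl// -(fineK (integrable_fin_num _ (inW n)))//.
  rewrite -[fine _]/(\int[P]_w (W w * Q w ^+ n)).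
  rewrite (Rintegral_tilted_sqdev _ K0 s0 X_indep X_normal) -EFinM; congr EFin.
  rewrite -/C mulrA [RHS]mulrC; congr (_ * _).
  (* Since K - 1 + 2 i = 2 (i + a), the moment contains the rising factorial of the denominator;
     what remains per degree is 2 s^2 beta^2 / (4 K) = la. *)
  rewrite (_ : \prod_(i < n) _ = (2 * s ^+ 2) ^+ n * \prod_(i < n) (i%:R + a)).
    have q0 : \prod_(i < n) (i%:R + a) != 0.
      by rewrite prodf_seq_neq0; apply/allP => i _ /=; rewrite gt_eqF// ltr_wpDl.
    have f0 : n`!%:R != 0 :> R by rewrite pnatr_eq0 -lt0n fact_gt0.
    rewrite /k0 /exp_coeff/= /la.
    rewrite (_ : beta ^+ 2 * s ^+ 2 / (2 * K%:R) =
      (2 * s ^+ 2) * (beta ^+ 2 / (4 * K%:R))); last by field.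
    rewrite [in RHS]exprMn.
    move: (_ ^+ n) (\prod_(i < n) _) q0 ((_ / _) ^+ n) => A B B0 D.
    by field; rewrite B0 f0.
  rewrite -[n in (2 * s ^+ 2) ^+ n]card_ord -prodr_const -big_split/=.
  by apply: eq_bigr => i _; rewrite /a; field.
pose f n w := W w * ((-1) ^+ n * bessel_term a (y w) n).
have mf n : measurable_fun setT (f n).
  rewrite (_ : f n = fun w => (-1) ^+ n * k0 n * (W w * Q w ^+ n)).
    apply: measurable_funM => //; apply/measurable_EFinP.
    exact: measurable_int (inW n).
  by apply/funext => w; rewrite -[RHS]mulrA -WtE /f mulrCA.
have absf n w : `|f n w| = W w * bessel_term a (y w) n.
  rewrite /f normrM (ger0_norm (expR_ge0 _)) normrM normrX normrN1 expr1n mul1r.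
  by rewrite ger0_norm// bessel_term_ge0.
have sumf : (\sum_(n <oo) \int[P]_w `|f n w|%:E < +oo)%E.
  have -> : (\sum_(n <oo) \int[P]_w `|f n w|%:E = (C * expR la)%:E)%E.
    under eq_eseriesr => n _.
      under eq_integral do rewrite absf.
      rewrite momE.
      over.
    apply/cvg_lim => //.
    under eq_fun do rewrite sumEFin -mulr_sumr.
    apply: cvg_EFin; first exact: nearW.
    apply: cvgMr; exact: is_cvg_series_exp_coeff.
  exact: ltry.
have s20 w : 0 <= sample_var (X^~ w).
  by rewrite mulr_ge0// ?invr_ge0 ?(ltW K1)//; exact: Q0.
have cvf w : series (f ^~ w) n @[n --> \oo] -->
    W w * bessel_factor beta (sample_var (X^~ w)) K.
  rewrite (_ : series _ = fun n => W w *
      series (fun n => (-1) ^+ n * bessel_term a (y w) n) n); last first.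
    by apply/funext => n; rewrite /series/= mulr_sumr.
  by apply: cvgMr; exact: cvg_series_bessel_factor.
have cv := cvg_integral_series mf sumf cvf.
rewrite -(cvg_lim _ cv)//; apply/cvg_lim => //.
have inT n : P.-integrable setT (fun w => (W w * bessel_term a (y w) n)%:E).
  by under eq_fun do rewrite WtE EFinM; exact: integrableZl.
have fE n w : (f n w)%:E = (((-1) ^+ n)%:E * (W w * bessel_term a (y w) n)%:E)%E.
  by rewrite -EFinM /f mulrCA.
have -> : (fun n => \int[P]_w (series (f^~ w) n)%:E)%E =
    (fun n => (C * series (exp_coeff (- la)) n)%:E).
  apply/funext => n.
  under eq_integral do rewrite /series/= -sumEFin.
  rewrite integral_sum//; last first.
    by move=> i; under eq_fun do rewrite fE; exact: integrableZl.
  rewrite /series/= mulr_sumr -sumEFin; apply: eq_bigr => i _.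
  under eq_integral do rewrite fE.
  rewrite integralZl// momE -EFinM mulrCA; congr (C * _)%:E.
  by rewrite /exp_coeff/= mulrA -exprMn mulN1r.
rewrite expRD -/C -/la.
have cve : C * series (exp_coeff (- la)) n @[n --> \oo] --> C * expR (- la).
  by apply: cvgMr; exact: is_cvg_series_exp_coeff.
exact: cvg_comp cve _.
Qed.

End tilted_bessel.

Theorem proposition3p1 (d : measure_display) (T : measurableType d)
    (R : realType) (P : probability T R)
    (K : nat) (hK : (2 <= K)%N) (l sigma2 : R) (hsigma2 : 0 < sigma2)
    (X : 'I_K -> {RV P >-> R})
    (X_indep : independent_RVs X)
    (X_normal : forall k, normal_RV (X k) l (Num.sqrt sigma2))
    (beta : R) (hbeta : 0 <= beta) :
  let lbar := fun w => sample_mean (fun k => X k w) in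
  let S2 := fun w => sample_var (fun k => X k w) in
  ('E_P[fun w => bessel_factor beta (S2 w) K]
     = (expR (- (beta ^+ 2 * sigma2 / (2 * K%:R))))%:E)%E
  /\ ('E_P[fun w => (expR (- (beta * lbar w)) * bessel_factor beta (S2 w) K)%R]
     = (expR (- (beta * l)))%:E)%E.
Proof.
move=> lbar S2.
have KR : K%:R != 0 :> R by rewrite pnatr_eq0 -lt0n (ltn_trans _ hK).
have s0 : Num.sqrt sigma2 != 0 by rewrite gt_eqF ?sqrtr_gt0.
have s2E : Num.sqrt sigma2 ^+ 2 = sigma2 by rewrite sqr_sqrtr ?ltW.
have main c := integral_tilted_bessel_factor c hK s0 X_indep X_normal hbeta.
rewrite !unlock; split.
- transitivity (\int[P]_w (expR (- (0 * \sum_k X k w)) *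
    bessel_factor beta (S2 w) K)%:E)%E.
    by apply: eq_integral => w _; rewrite mul0r oppr0 expR0 mul1r.
  by rewrite main s2E; congr (expR _)%:E; field.
(* With c = beta / K the weight is exp(- beta lbar). Its mean exceeds exp(- beta l) by the factor
   exp(beta^2 sigma2 / (2 K)), which the Bessel factor cancels exactly. *)
- transitivity (\int[P]_w (expR (- (beta / K%:R * \sum_k X k w)) *
    bessel_factor beta (S2 w) K)%:E)%E.
    by apply: eq_integral => w _; rewrite /lbar /sample_mean mulrA.
  by rewrite main s2E; congr (expR _)%:E; field.
Qed.
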